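(* Let $(\mathcal{A},R)$ be a crystallographic arrangement in $V=\mathbb{R}^r$ and $M=\sum_{\alpha\in R}\mathbb{Z}\alpha\subseteq V^*$. For a chamber $K\in\mathcal{K}(\mathcal{A})$ let $$\rho^K:=\frac12\sum_{\alpha\in R^K_+}\alpha .$$ Then the set $\{\rho^K\mid K\in\mathcal{K}(\mathcal{A})\}$ is the set of vertices of a convex polytope $P$ in $V^*$ which is integral with respect to the lattice $\frac12 M$.
   Context: A simplicial arrangement $\mathcal{A}$ in $V=\mathbb{R}^r$ is a finite set of distinct linear hyperplanes such that every connected component (chamber) of $V\setminus\bigcup_{H\in\mathcal{A}}H$ is an open simplicial cone; $\mathcal{K}(\mathcal{A})$ is the set of chambers. Let $R\subseteq V^*$ be a finite set with $\mathcal{A}=\{\alpha^\perp\mid\alpha\in R\}$ and $\mathbb{R}\alpha\cap R=\{\pm\alpha\}$ for all $\alpha\in R$. For $K\in\mathcal{K}(\mathcal{A})$ let $B^K$ be the set of $\alpha\in R$ such that $\alpha\ge0$ on $K$ and $\dim(\alpha^\perp\cap\overline K)=r-1$, and let $R^K_+=R\cap\sum_{\alpha\in B^K}\mathbb{R}_{\ge0}\alpha$. The pair $(\mathcal{A},R)$ is a crystallographic arrangement if $R\subseteq\sum_{\alpha\in B^K}\mathbb{Z}\alpha$ for all $K\in\mathcal{K}(\mathcal{A})$. A polytope is integral with respect to a lattice if all its vertices lie in that lattice. *)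

(* Defs.v *)
From mathcomp Require Import all_boot all_order all_algebra finmap.
From mathcomp Require Import all_classical reals topology.

Set Implicit Arguments.
Unset Strict Implicit.
Unset Printing Implicit Defensive.

Import Order.TTheory GRing.Theory Num.Theory.
Import numFieldTopology.Exports.

Local Open Scope classical_set_scope.
Local Open Scope ring_scope.

Section Spans.
Context (F : realType) (W : vectType F).
Implicit Types (s : seq W) (X P L : set W).

Definition nonneg_span s : set W :=
  [set v | exists2 c : W -> F,
     (forall x, x \in s -> 0 <= c x) & v = \sum_(x <- s) c x *: x].

Definition int_span s : set W :=
  [set v | exists c : W -> int, v = \sum_(x <- s) x *~ c x].

(* The dimension of the linear span of [X]; this is the dimension of [X] when
   [X] is a cone containing the origin. *)
Definition has_dim X (d : nat) :=
  exists s : seq W,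
    [/\ [set` s] `<=` X, X `<=` [set` (span s)] & \dim (span s) = d].

Definition open_simplicial_cone X :=
  exists2 b : (\dim {:W}).-tuple W, basis_of fullv b &
    X = [set x | exists2 c : 'I_(\dim {:W}) -> F,
                   (forall i, 0 < c i) & x = \sum_i c i *: b`_i].

Definition is_lattice L :=
  exists2 b : seq W, basis_of fullv b & L = int_span b.

Definition conv_hull s : set W :=
  [set v | exists c : W -> F,
     [/\ forall x, x \in s -> 0 <= c x, \sum_(x <- s) c x = 1
       & v = \sum_(x <- s) c x *: x]].

Definition polytope P := exists2 s : seq W, s != [::] & P = conv_hull s.

(* The zero-dimensional faces: [v] is a vertex when some linear functional
   attains its maximum over [P] at [v] only. *)
Definition vertices P : set W :=
  [set v | P v /\ exists l : 'Hom(W, F^o), forall w, P w -> w != v -> l w < l v].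

Definition integral_wrt L P := is_lattice L /\ vertices P `<=` L.

End Spans.

Section Arrangements.
Context (F : realType) (r : nat).
Notation V := 'rV[F]_r.
Notation dualV := 'Hom('rV[F]_r, F^o).
Implicit Types (A : {fset {vspace V}}) (R : {fset dualV}) (K : set V).

Definition complement A : set V := ~` \bigcup_(H in [set` A]) [set` H].

Definition chambers A : set (set V) :=
  [set connected_component (complement A) x | x in complement A].

Definition simplicial_arrangement A :=
  (forall H, H \in A -> (\dim H).+1 = r) /\
  (forall K, chambers A K -> open_simplicial_cone K).

(* [lker a] is the hyperplane orthogonal to [a]; since the elements of an
   arrangement are hyperplanes, the first condition excludes [0] from [R]. *)
Definition root_set_of A R :=
  [set` A] = [set lker a | a in [set` R]] /\
  (forall a, a \in R -> [set c *: a | c in [set: F]] `&` [set` R] = [set a; - a]).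

Definition basis_at R K : {fset dualV} :=
  [fset a in R | `[< (forall x, K x -> 0 <= a x) /\
     exists2 d, has_dim ([set` lker a] `&` closure K) d & d.+1 = r >]]%fset.

Definition positive_roots R K : {fset dualV} :=
  [fset a in R | `[< nonneg_span (basis_at R K) a >]]%fset.

Definition crystallographic_arrangement A R :=
  [/\ simplicial_arrangement A, root_set_of A R &
      forall K, chambers A K -> [set` R] `<=` int_span (basis_at R K)].

Definition rho R K : dualV := 2^-1 *: \sum_(a <- positive_roots R K) a.

Definition half_root_lattice R : set dualV :=
  [set (2^-1 : F) *: m | m in int_span R].

End Arrangements.

(* Main.v *)
(* A chamber K is the set of points where every root has the sign that it has
   at a given x in K. If K is the open cone on a basis b, the elements of B^K
   are positive multiples of the basis dual to b, one for each dual vector: the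
   sum of all the b_j with j <> i lies in the closure of K but not in K, so
   some root vanishes at b_j for exactly the j <> i. Hence B^K is a basis of
   V^*, the positive roots are those positive at x, and M is spanned over Z by
   B^K. Evaluation at x sends rho^K' to half of the sum of a(x) over the roots
   a that are positive on K', and this is largest exactly when those roots are
   the ones positive at x. So each rho^K is an exposed point of the convex hull
   of all of them. *)

From HB Require Import structures.
Require Import Defs.
From mathcomp Require Import all_boot all_order all_algebra finmap.
From mathcomp Require Import all_classical reals topology normedtype.

Set Implicit Arguments.
Unset Strict Implicit.
Unset Printing Implicit Defensive.

Import Order.TTheory GRing.Theory Num.Theory.
Import numFieldNormedType.Exports.

Local Open Scope classical_set_scope.
Local Open Scope ring_scope.

(** * Continuity of functionals and of lines *)

Lemma lfun_continuous (F : realType) (r : nat) (a : 'Hom('rV[F]_r, F^o)) :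
  continuous (a : 'rV[F]_r -> F).
Proof.
have -> : (a : 'rV[F]_r -> F) = fun x => \sum_j a (delta_mx 0 j) * x 0 j.
  apply/funext => x; rewrite {1}(row_sum_delta x) linear_sum /=.
  by apply: eq_bigr => j _; rewrite linearZ /= mulrC.
apply: continuous_big => [|j _]; first exact: add_continuous.
by move=> x; apply: (@cvgMl_tmp F _ _ (nbhs_filter x)); exact: coord_continuous.
Qed.

Lemma line_continuous (F : realType) (r : nat) (x v : 'rV[F]_r) :
  continuous (fun t : F => x + t *: v).
Proof.
move=> t; apply: cvgD; first exact: cvg_cst.
by apply: cvgZ; [exact: cvg_id|exact: cvg_cst].
Qed.

(** * Chambers as regions of constant sign *)

Section SignRegion.
Context (F : realType) (r : nat).
Implicit Types (R : {fset 'Hom('rV[F]_r, F^o)}) (A : {fset {vspace 'rV[F]_r}}).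

Definition sign_region R (x : 'rV[F]_r) : set 'rV[F]_r :=
  [set y | forall a, a \in R -> 0 < a x * a y].

Lemma complementE A R (x : 'rV[F]_r) : root_set_of A R ->
  complement A x <-> forall a, a \in R -> a x != 0.
Proof.
move=> [AR _]; split=> [Ax a aR|Rx].
- apply/eqP => ax0; apply: Ax; exists (lker a); last by rewrite /= memv_ker ax0.
  by rewrite AR; exists a.
- move=> [H]; rewrite AR => -[a aR <-] /=.
  by rewrite memv_ker; apply/negP; exact: Rx.
Qed.

Lemma sign_region_refl R x : (forall a, a \in R -> a x != 0) ->
  sign_region R x x.
Proof. by move=> Rx a /Rx; rewrite -expr2 exprn_even_gt0. Qed.

Lemma sign_region_segment R x y z (t : F) :
  sign_region R x y -> sign_region R x z -> 0 <= t <= 1 ->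
  sign_region R x (y + t *: (z - y)).
Proof.
move=> xy xz /andP[t0 t1] a aR; rewrite linearD linearZ /= linearB /=.
have {}xy := xy _ aR; have {}xz := xz _ aR.
rewrite -[_ *: (_ : F^o)]/(_ * _).
have -> : a x * (a y + t * (a z - a y))
  = (1 - t) * (a x * a y) + t * (a x * a z).
  rewrite mulrDr mulrBl mul1r mulrBr mulrBr -addrA; congr (_ + _).
  by rewrite addrC mulrCA; congr (_ - _); rewrite mulrCA.
(* For [t = 0] strictness comes from the first term; otherwise the second term is positive and the
   first nonnegative. *)
have [->|tn0] := eqVneq t 0; first by rewrite subr0 mul1r mul0r addr0.
apply: ltr_wpDl; first by rewrite mulr_ge0 ?subr_ge0 ?(ltW xy).
by rewrite mulr_gt0// lt_def tn0.
Qed.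

(** The region is star-shaped about [x]: it is a union of segments that all contain [x]. *)
Lemma connected_sign_region R x : (forall a, a \in R -> a x != 0) ->
  connected (sign_region R x).
Proof.
move=> Rx.
have -> : sign_region R x = \bigcup_(y in sign_region R x)
    [set x + t *: (y - x) | t in `[0, 1]].
  apply/seteqP; split=> [y xy|y [z xz [t]]].
    exists y => //; exists 1; first by rewrite /= in_itv /= ler01 lexx.
    by rewrite scale1r addrC subrK.
  rewrite /= in_itv /= => t01 <-.
  by apply: sign_region_segment t01 => //; exact: sign_region_refl.
apply: bigcup_connected => [|y xy].
  exists x => y xy; exists 0; rewrite ?scale0r ?addr0//=.
  by rewrite in_itv /= lexx ler01.
apply: connected_continuous_connected; first exact: segment_connected.
by apply: continuous_subspaceT; exact: line_continuous.
Qed.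

(** On the component a root takes an interval of values that avoids 0, so its sign is constant
    there. Conversely, the sign region is a connected subset of the complement containing [x]. *)
Lemma connected_component_complement A R x : root_set_of A R ->
  complement A x -> connected_component (complement A) x = sign_region R x.
Proof.
move=> AR Ax; have Rx := (complementE x AR).1 Ax.
apply/seteqP; split.
- move=> y xy a aR; set C := connected_component _ _ in xy.
  have : is_interval [set a z | z in C].
    apply/connected_intervalP; apply: connected_continuous_connected.
      exact: component_connected.
    by apply: continuous_subspaceT; exact: lfun_continuous.
  have Cx : C x by exact: connected_component_refl.
  move=> aC; have aC0 : ~ [set a z | z in C] 0.
    move=> [z Cz az0]; have := connected_component_sub Cz.
    by move=> /(complementE z AR) /(_ _ aR); rewrite az0 eqxx.
  have ax := Rx _ aR; have ay : a y != 0.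
    by apply/eqP => ay; apply: aC0; exists y.
  have [ax0|ax0|/eqP] := ltgtP (a x) 0; last by rewrite (negPf ax).
  + rewrite nmulr_rgt0//; have [//|ay0|/eqP] := ltgtP (a y) 0.
      exfalso; apply: aC0; apply: (aC (a x) (a y)) => //.
      * by exists x. * by exists y. * by rewrite (ltW ax0) (ltW ay0).
    by rewrite (negPf ay).
  + rewrite pmulr_rgt0//; have [ay0|//|/eqP] := ltgtP (a y) 0.
      exfalso; apply: aC0; apply: (aC (a y) (a x)) => //.
      * by exists y. * by exists x. * by rewrite (ltW ax0) (ltW ay0).
    by rewrite (negPf ay).
- apply: connected_component_max.
  + exact: sign_region_refl.
  + move=> y xy; apply/(complementE y AR) => a /xy.
    by apply: contraTneq => ->; rewrite mulr0 ltxx.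
  + exact: connected_sign_region.
Qed.

Lemma closure_sign_region_ge0 R x y a :
  closure (sign_region R x) y -> a \in R -> 0 <= a x * a y.
Proof.
rewrite closureE => cly aR; apply: (cly [set z | 0 <= a x * a z]); split.
  apply: (@preimage_closed _ _ (fun z => a x * a z : F) [set u | 0 <= u]).
    move=> z _; apply: (@cvgMl_tmp F _ _ (nbhs_filter z)).
    exact: lfun_continuous.
  exact: closed_ge.
by move=> z xz; exact/ltW/xz.
Qed.

(** Adding a positive multiple of [x] turns the weak inequalities valid on the closure into strict
    ones; conversely [y] is the limit of [y + t *: x] as [t] decreases to 0. *)
Lemma closure_sign_region R x y : (forall a, a \in R -> a x != 0) ->
  closure (sign_region R x) y <->
  forall t : F, 0 < t -> sign_region R x (y + t *: x).
Proof.
move=> Rx; split.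
- move=> cly t t0 a aR; rewrite linearD linearZ /= mulrDr.
  rewrite -[_ *: (_ : F^o)]/(_ * _).
  have axx : 0 < a x * a x by exact: (sign_region_refl Rx aR).
  by rewrite ltr_wpDl ?(closure_sign_region_ge0 cly aR)// mulrCA mulr_gt0.
- move=> xy B By.
  have : (fun t : F => y + t *: x) @ 0^'+ --> y.
    apply: cvg_at_right_filter.
    have /= := @line_continuous F r y x 0.
    by rewrite /continuous_at scale0r addr0.
  move=> /(_ _ By) /= yB.
  have [t [t0 Bt]] : exists t : F, 0 < t /\ B (y + t *: x).
    have := filter_ex (filterI (nbhs_right_gt (0:F)) yB).
    by move=> [t [/= t0 Bt]]; exists t.
  by exists (y + t *: x); split => //; exact: xy.
Qed.

End SignRegion.

(** * Walls of a simplicial chamber, the basis $B^K$ and the positive roots *)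

Lemma root_set_opp (F : realType) (r : nat) (A : {fset {vspace 'rV[F]_r}})
    (R : {fset 'Hom('rV[F]_r, F^o)}) a :
  root_set_of A R -> a \in R -> - a \in R.
Proof.
move=> [_ /(_ a) Ra] aR.
have : [set a; - a] (- a) by right.
by rewrite -Ra// => -[].
Qed.

Lemma eq_lfun_basis (F : fieldType) (V W : vectType F) n (b : n.-tuple V)
    (f g : 'Hom(V, W)) : basis_of fullv b ->
  (forall i : 'I_n, f b`_i = g b`_i) -> f = g.
Proof.
move=> bb fg; apply/lfunP => v; rewrite (coord_basis bb (memvf v)) !linear_sum.
by apply: eq_bigr => i _; rewrite !linearZ /= fg.
Qed.

Section Walls.
Context (F : realType) (r : nat).
Context (A : {fset {vspace 'rV[F]_r}}) (R : {fset 'Hom('rV[F]_r, F^o)}).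
Context (x : 'rV[F]_r) (b : (\dim {:'rV[F]_r}).-tuple 'rV[F]_r).
Hypothesis rootR : root_set_of A R.
Hypothesis Rx : forall a, a \in R -> a x != 0.
Hypothesis bb : basis_of fullv b.
Hypothesis coneE : sign_region R x =
  [set y | exists2 c : 'I_(\dim {:'rV[F]_r}) -> F,
             (forall i, 0 < c i) & y = \sum_i c i *: b`_i].
Let K := sign_region R x.

(** Up to a positive factor, [a] is the [i]-th vector of the basis dual to [b]. *)
Definition wall_of (i : 'I_(\dim {:'rV[F]_r})) (a : 'Hom('rV[F]_r, F^o)) :=
  0 < a b`_i /\ forall j, j != i -> a b`_j = 0.

Let free_b : free b := basis_free bb.

Lemma lfun_coord (a : 'Hom('rV[F]_r, F^o)) y :
  a y = \sum_i coord b i y * a b`_i.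
Proof.
rewrite {1}(coord_basis bb (memvf y)) linear_sum.
by apply: eq_bigr => i _; rewrite linearZ.
Qed.

Lemma cone_coord y : K y <-> forall i, 0 < coord b i y.
Proof.
rewrite /K coneE; split=> [[c c0 ->] i|y0]; first by rewrite coord_sum_free.
by exists (fun i => coord b i y) => //; exact: coord_basis (memvf y).
Qed.

Lemma coord_gt0 i : 0 < coord b i x.
Proof. exact: (cone_coord x).1 (sign_region_refl Rx) i. Qed.

Lemma closure_cone_coord y : closure K y <-> forall i, 0 <= coord b i y.
Proof.
have x0 := coord_gt0.
apply: (iff_trans (closure_sign_region y Rx)); split=> [yx i|y0 t t0].
- rewrite leNgt; apply/negP => yi.
  (* The factor of [x] is chosen so that the [i]-th coordinate becomes exactly 0, which no point of
     [K] allows. *)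
  have /cone_coord/(_ i) : K (y + (- coord b i y / coord b i x) *: x).
    by apply: yx; rewrite divr_gt0// oppr_gt0.
  by rewrite linearD linearZ /= divfK ?subrr ?ltxx// gt_eqF.
- apply/cone_coord => i; rewrite linearD linearZ /=.
  by rewrite ltr_wpDl// mulr_gt0.
Qed.

Lemma closure_cone_basis (i : 'I_(\dim {:'rV[F]_r})) : closure K b`_i.
Proof.
by apply/closure_cone_coord => j; rewrite coord_free// ler0n.
Qed.

Lemma root_basis_ge0 a (i : 'I_(\dim {:'rV[F]_r})) :
  a \in R -> 0 < a x -> 0 <= a b`_i.
Proof.
move=> aR ax; rewrite -(pmulr_rge0 _ ax).
exact: closure_sign_region_ge0 (@closure_cone_basis i) aR.
Qed.

Lemma wall_of_gt0 i a : wall_of i a -> 0 < a x.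
Proof.
move=> [ai aj]; rewrite lfun_coord (bigD1 i)//= big1 => [|j /aj ->].
  by rewrite addr0 mulr_gt0// coord_gt0.
by rewrite mulr0.
Qed.

Lemma exists_wall i : exists2 a, a \in R & wall_of i a.
Proof.
pose p : 'rV[F]_r := \sum_(j | j != i) b`_j.
have clp : closure K p.
  apply/closure_cone_coord => j; rewrite linear_sum sumr_ge0// => k _.
  by rewrite /= coord_free// ler0n.
have /existsNP[a' /not_implyP[a'R a'p]] : ~ K p.
  move=> /cone_coord/(_ i); rewrite linear_sum big1 ?ltxx// => j ji.
  by rewrite /= coord_free// (negPf ji).
(* The product [a' x * a' p] is nonnegative because [p] is in the closure and not positive by choice
   of [a'], so [a'] vanishes at [p]. If [a'] is negative at [x], its opposite is taken. *)
have {a' a'R a'p} [a [aR ax ap]] : exists a, [/\ a \in R, 0 < a x & a p = 0].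
  have a'p0 : a' p = 0.
    have : a' x * a' p == 0.
      rewrite eq_le (closure_sign_region_ge0 clp a'R) leNgt andbT.
      exact/negP.
    by rewrite mulf_eq0 (negPf (Rx a'R)) => /eqP.
  have [a'x|a'x|/eqP] := ltgtP (a' x) 0; last by rewrite (negPf (Rx a'R)).
    exists (- a'); rewrite !opp_lfunE a'p0 oppr0 oppr_gt0; split => //.
    exact: root_set_opp rootR a'R.
  by exists a'.
(* All values of [a] on the generators are nonnegative, so a zero sum forces each term to vanish. *)
have aj j : j != i -> a b`_j = 0.
  move: ap; rewrite linear_sum /= => /psumr_eq0P; apply => k _.
  exact: root_basis_ge0.
exists a => //; split => //.
have := ax; rewrite lfun_coord (bigD1 i)//= big1 => [|j /aj ->].
  by rewrite addr0 pmulr_rgt0// coord_gt0.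
exact: mulr0.
Qed.

(** Both roots are multiples of the same dual vector, so [a'] is [a] or [- a]; positivity at the
    [i]-th generator rules out [- a]. *)
Lemma wall_of_inj i a a' : a \in R -> a' \in R ->
  wall_of i a -> wall_of i a' -> a' = a.
Proof.
move=> aR a'R [ai aj] [a'i a'j].
have a'E : a' = (a' b`_i / a b`_i) *: a.
  apply: (eq_lfun_basis bb) => j; rewrite scale_lfunE.
  have [->|ji] := eqVneq j i; last by rewrite (aj _ ji) (a'j _ ji) scaler0.
  by rewrite -[_ *: (_ : F^o)]/(_ * _) divfK// gt_eqF.
have : ([set c *: a | c in [set: F]] `&` [set` R]) a'.
  by split=> //; exists (a' b`_i / a b`_i).
rewrite rootR.2// => -[//|/= a'N].
by move: a'i; rewrite a'N opp_lfunE oppr_gt0 ltNge (ltW ai).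
Qed.

(** Expanding [y] in [b] writes [a y] as a sum of nonnegative terms. If it is 0, only generators
    killed by [a] have nonzero coordinates. *)
Lemma face_sub_span a : a \in R -> 0 < a x ->
  [set` lker a] `&` closure K `<=` [set` <<[seq v <- b | a v == 0%R]>>%VS].
Proof.
move=> aR ax y [/=]; rewrite memv_ker => /eqP + /closure_cone_coord y0.
rewrite lfun_coord => /psumr_eq0P ay.
rewrite (coord_basis bb (memvf y)); apply: memv_suml => i _.
have := ay (fun i _ => mulr_ge0 (y0 i) (root_basis_ge0 i aR ax)) i isT.
move=> /eqP; rewrite mulf_eq0 => /orP[/eqP->|ai].
  by rewrite scale0r mem0v.
by apply/memvZ/memv_span; rewrite mem_filter ai mem_nth ?size_tuple.
Qed.

(** The face cut out by a root positive at [x] is generated by the generators that the root kills,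
    so it has dimension r - 1 exactly when all but one are killed. *)
Lemma basis_atP a : (a \in basis_at R K) <-> (a \in R /\ exists i, wall_of i a).
Proof.
have dimV : \dim {:'rV[F]_r} = r by rewrite dimvf /dim /= mul1n.
rewrite /basis_at !inE /=; split.
- move=> /andP[aR /asboolP[a0 [d [s [sX Xs <-]] ds]]].
  have ax : 0 < a x by rewrite lt_def (Rx aR) a0//; exact: sign_region_refl.
  split=> //.
  have [i ai] : exists i : 'I_(\dim {:'rV[F]_r}), a b`_i != 0.
    apply: contrapT => /forallNP a00; have := ax.
    rewrite lfun_coord big1 ?ltxx// => i _.
    by have /negP/negPn/eqP-> := a00 i; rewrite mulr0.
  exists i; split=> [|j ji]; first by rewrite lt_def ai root_basis_ge0.
  apply: contrapT => /eqP aj.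
  have : (\dim <<s>> <= size [seq v <- b | a v == 0%R])%N.
    apply: leq_trans (dim_span _); apply: dimvS; apply/span_subvP => v vs.
    exact: (face_sub_span aR ax (sX _ vs)).
  (* If a were positive on two generators, the face where it vanishes would be
     spanned by at most r - 2 of them. *)
  apply/negP; rewrite -ltnNge -ltnS ds.
  have sz : (2 <= size [seq v <- b | a v != 0%R])%N.
    rewrite -[2%N]/(size [:: b`_i; b`_j]) uniq_leq_size//.
      by rewrite /= inE andbT (nth_uniq 0) ?size_tuple ?free_uniq// eq_sym.
    move=> v; rewrite !inE mem_filter => /orP[/eqP->|/eqP->];
      by rewrite ?ai ?aj mem_nth ?size_tuple.
  rewrite -[X in (_ < X)%N]dimV -{2}(size_tuple b).
  rewrite -(count_predC (fun v => a v == 0) b).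
  by rewrite -!size_filter -addn2 leq_add2l.
- move=> [aR [i ai]]; rewrite aR; apply/asboolP.
  have ax := wall_of_gt0 ai.
  split=> [y Ky|]; first by rewrite -(pmulr_rge0 _ ax); exact/ltW/Ky.
  have bi : b`_i \in tval b by rewrite mem_nth// size_tuple.
  have remE v : v \in rem b`_i b -> a v = 0 /\ closure K v.
    rewrite mem_rem_uniq ?free_uniq// !inE => /andP[vi /(nthP 0)[j]].
    rewrite size_tuple => jb vE; rewrite -{}vE in vi *.
    split; last exact: (@closure_cone_basis (Ordinal jb)).
    by apply: (ai.2 (Ordinal jb)); apply: contra_neq vi => <-.
  exists (size (rem b`_i b)); last first.
    (* The index [i] witnesses that the dimension is positive, so its predecessor is a true one. *)
    rewrite size_rem// size_tuple prednK ?dimV// -dimV.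
    by rewrite (leq_ltn_trans _ (ltn_ord i)).
  exists (rem b`_i b); split.
  + by move=> v /= /remE [av clv]; split=> //=; rewrite memv_ker av.
  + apply: subset_trans (face_sub_span aR ax) _ => y /=.
    apply/subvP/sub_span => v; rewrite mem_filter => /andP[/eqP av vb].
    rewrite mem_rem_uniq ?free_uniq// !inE vb andbT.
    by apply: contraTneq ai.1 => <-; rewrite av ltxx.
  + apply/eqP; rewrite -/(free _); have := free_b.
    by rewrite (perm_free (perm_to_rem bi)) free_cons => /andP[].
Qed.

(* The coefficient of [a] in the expansion of [f] over the walls; for a wall the
   sum has a single term. *)
Definition dual_coord (f a : 'Hom('rV[F]_r, F^o)) : F :=
  \sum_(i < \dim {:'rV[F]_r} | 0 < a b`_i) (f b`_i / a b`_i).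

(** Both sides agree on each generator, where exactly one element of $B^K$ is nonzero. *)
Lemma dual_coordE f : f = \sum_(a <- basis_at R K) dual_coord f a *: a.
Proof.
apply: (eq_lfun_basis bb) => i; have [a aR ai] := exists_wall i.
have aB : a \in basis_at R K by apply/basis_atP; split => //; exists i.
rewrite (bigD1_seq a)//= add_lfunE sum_lfunE scale_lfunE.
rewrite big_seq_cond big1 ?addr0.
  rewrite /dual_coord (bigD1 i) ?ai.1//= big1 ?addr0 => [|j /andP[+ ji]].
    by rewrite -[_ *: (_ : F^o)]/(_ * _) divfK// gt_eqF ?ai.1.
  by rewrite ai.2// ltxx.
move=> a' /andP[/basis_atP[a'R [j a'j]] a'a].
rewrite scale_lfunE a'j.2 ?scaler0//.
apply: contraNneq a'a => ij; rewrite -ij in a'j.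
by rewrite (wall_of_inj aR a'R ai a'j).
Qed.

(** The expansion shows that $B^K$ spans, and having only one wall per generator bounds its size by
    the dimension. *)
Lemma basis_at_basis : basis_of fullv (basis_at R K).
Proof.
rewrite basisEdim; apply/andP; split.
  apply/subvP => f _; rewrite (dual_coordE f) big_seq memv_suml// => a aB.
  by rewrite memvZ// memv_span.
have /choice[w wP] i : exists a, a \in R /\ wall_of i a.
  by have [a] := exists_wall i; exists a.
have -> : \dim {:'Hom('rV[F]_r, F^o)} =
    size (map w (enum 'I_(\dim {:'rV[F]_r}))).
  by rewrite size_map size_enum_ord !dimvf /dim /= muln1.
apply: uniq_leq_size (fset_uniq _) _ => a /basis_atP[aR [i ai]].
have [wR wi] := wP i.
by rewrite (wall_of_inj wR aR wi ai) map_f// mem_enum.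
Qed.

(** Walls are positive at [x], hence so is a root in their cone. Conversely a root positive at [x]
    is nonnegative on the generators, which makes its coefficients over $B^K$ nonnegative. *)
Lemma mem_positive_roots a :
  (a \in positive_roots R K) = (a \in R) && (0 < a x).
Proof.
rewrite /positive_roots !inE /=; have [aR/=|//] := boolP (a \in R).
apply/asboolP/idP => [[c c0 aE]|ax].
- rewrite lt_def Rx// aE sum_lfunE big_seq sumr_ge0// => d dB.
  rewrite scale_lfunE mulr_ge0 ?c0//.
  by have /basis_atP[_ [i /wall_of_gt0/ltW]] := dB.
- exists (dual_coord a); last exact: dual_coordE.
  move=> d _; rewrite /dual_coord sumr_ge0// => i di.
  by rewrite divr_ge0 ?(ltW di)// root_basis_ge0.
Qed.

Lemma rho_sign_region : rho R K = 2^-1 *: \sum_(a <- R | 0 < a x) a.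
Proof.
rewrite /rho -[in RHS]big_filter; congr (_ *: _); apply: perm_big.
apply: uniq_perm; rewrite ?filter_uniq// => a.
by rewrite mem_filter mem_positive_roots andbC.
Qed.

End Walls.

(** * Integer spans and lattices *)

Section IntSpan.
Context (F : realType) (W : vectType F).
Implicit Types (s t : seq W).

Lemma int_span0 s : int_span s 0.
Proof. by exists (fun=> 0); rewrite big1. Qed.

Lemma int_spanD s v w : int_span s v -> int_span s w -> int_span s (v + w).
Proof.
move=> [c ->] [d ->]; exists (fun x => c x + d x).
by rewrite -big_split; apply: eq_bigr => x _; rewrite mulrzDr.
Qed.

Lemma int_spanMz s v n : int_span s v -> int_span s (v *~ n).
Proof.
move=> [c ->]; exists (fun x => c x * n).
by rewrite mulrz_suml; apply: eq_bigr => x _; rewrite mulrzA.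
Qed.

(** Coefficients are attached to vectors, not positions: a repeated entry would be counted several
    times, hence [uniq s]. *)
Lemma int_span_mem s v : uniq s -> v \in s -> int_span s v.
Proof.
move=> us vs; exists (fun x => (x == v)%:Z).
by rewrite (bigD1_seq v)//= eqxx big1 ?addr0// => x /negPf ->.
Qed.

Lemma int_span_sub s t :
  (forall v, v \in s -> int_span t v) -> int_span s `<=` int_span t.
Proof.
move=> st v [c ->]; rewrite big_seq; apply: big_ind => [||x /st].
- exact: int_span0.
- exact: int_spanD.
- exact: int_spanMz.
Qed.

Lemma int_span_scale (k : F) s : k != 0 ->
  int_span [seq k *: x | x <- s] = [set k *: m | m in int_span s].
Proof.
move=> k0; apply/seteqP; split=> [v [c ->]|_ [_ [c ->] <-]].
- exists (\sum_(x <- s) x *~ c (k *: x)); first by exists (fun x => c (k *: x)).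
  by rewrite scaler_sumr big_map; apply: eq_bigr => x _; rewrite scalerMzr.
(* The new coefficients are read at scaled vectors, so the argument is scaled back. *)
- exists (fun x => c (k^-1 *: x)); rewrite scaler_sumr big_map.
  by apply: eq_bigr => x _; rewrite scalerMzr scalerA mulVf// scale1r.
Qed.

Lemma basis_scale (k : F) s : k != 0 ->
  basis_of fullv s -> basis_of fullv [seq k *: x | x <- s].
Proof.
move=> k0; rewrite !basisEdim size_map => /andP[sub ->]; rewrite andbT.
apply: subv_trans sub _; apply/span_subvP => v vs.
rewrite -[v]scale1r -(mulVf k0) -scalerA; apply/memvZ/memv_span.
exact: map_f.
Qed.

Lemma is_lattice_scale_int_span (k : F) s : k != 0 ->
  basis_of fullv s -> is_lattice [set k *: m | m in int_span s].
Proof.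
move=> k0 bs; exists [seq k *: x | x <- s]; first exact: basis_scale.
by rewrite int_span_scale.
Qed.

End IntSpan.

(** * Vertices of a convex hull *)

Section ConvexHull.
Context (F : realType) (W : vectType F).
Implicit Types (s : seq W).

Lemma conv_hull_mem s v : uniq s -> v \in s -> conv_hull s v.
Proof.
move=> us vs; exists (fun x => (x == v)%:R); split.
- by move=> x _; exact: ler0n.
- by rewrite (bigD1_seq v)//= eqxx big1 ?addr0// => x /negPf ->.
- rewrite (bigD1_seq v)//= eqxx scale1r big1 ?addr0// => x /negPf ->.
  exact: scale0r.
Qed.

(** The gap [l v - l w] is the weighted mean of the nonnegative gaps [l v - l u]. If it vanishes,
    all the weight sits on [v], so [w] is [v]. *)
Lemma conv_hull_exposed s v (l : 'Hom(W, F^o)) w :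
  (forall u, u \in s -> u != v -> l u < l v) ->
  conv_hull s w -> w != v -> l w < l v.
Proof.
move=> lv [c [c0 c1 wE]] wv.
have lvE : l v - l w = \sum_(u <- s) c u * (l v - l u).
  have -> : l w = \sum_(u <- s) c u * l u.
    by rewrite wE linear_sum; apply: eq_bigr => u _; rewrite linearZ.
  rewrite -[X in X - _]mul1r -c1 mulr_suml -sumrB.
  by apply: eq_bigr => u _; rewrite mulrBr.
have ge0 u : u \in s -> 0 <= c u * (l v - l u).
  move=> us; rewrite mulr_ge0 ?c0// subr_ge0.
  by have [->//|/(lv _ us)/ltW] := eqVneq u v.
rewrite -subr_gt0 lvE lt_def big_seq sumr_ge0// andbT.
apply: contra wv; rewrite psumr_eq0// => /allP cs.
have {}cs u : u \in s -> c u *: u = c u *: v.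
  move=> us; have := cs _ us; rewrite us /= mulf_eq0.
  have [->//|uv] := eqVneq u v.
  by rewrite subr_eq0 (gt_eqF (lv _ us uv)) orbF => /eqP ->; rewrite !scale0r.
rewrite wE (eq_big_seq _ cs) -scaler_suml c1 scale1r; exact: eqxx.
Qed.

(** At a vertex [v] outside [s] every gap [l v - l u] is positive while their weighted mean is 0, so
    all weights would vanish, against their sum 1. *)
Lemma vertices_conv_hull s : uniq s ->
  (forall v, v \in s -> exists l : 'Hom(W, F^o),
     forall u, u \in s -> u != v -> l u < l v) ->
  vertices (conv_hull s) = [set` s].
Proof.
move=> us ls; apply/seteqP; split=> [v [[c [c0 c1 vE]] [l lv]]|v /= vs].
- apply: contrapT => /= /negP vs.
  have le0 u : u \in s -> 0 <= c u * (l v - l u).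
    move=> us'; rewrite mulr_ge0 ?c0// subr_ge0 ltW// lv//.
      exact: conv_hull_mem.
    by apply: contraNneq vs => <-.
  have : \sum_(u <- s) c u * (l v - l u) = 0.
    have lE : l v = \sum_(u <- s) c u * l u.
      by rewrite {1}vE linear_sum; apply: eq_bigr => u _; rewrite linearZ.
    under eq_bigr do rewrite mulrBr.
    by rewrite sumrB -mulr_suml c1 mul1r -lE subrr.
  move/eqP; rewrite big_seq psumr_eq0// => /allP cs.
  have {}cs u : u \in s -> c u = 0.
    move=> us'; have uv : l u < l v.
      apply: lv; first exact: conv_hull_mem.
      by apply: contraNneq vs => <-.
    have := cs _ us'; rewrite us' /= mulf_eq0 subr_eq0 (gt_eqF uv) orbF.
    by move/eqP.
  by have := oner_neq0 F; rewrite -c1 big_seq big1 ?eqxx.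
- split; first exact: conv_hull_mem.
  have [l lv] := ls _ vs; exists l => w sw wv; exact: (conv_hull_exposed lv).
Qed.

End ConvexHull.

(* The points (1, t, t^2, ...) of the moment curve: a nonzero functional is a
   nonzero polynomial in t. *)
Lemma exists_nonvanishing (F : realType) (r : nat)
    (s : seq 'Hom('rV[F]_r, F^o)) :
  (forall a, a \in s -> a != 0) ->
  exists x, forall a, a \in s -> a x != 0.
Proof.
move=> s0.
pose p (a : 'Hom('rV[F]_r, F^o)) : {poly F} :=
  \sum_(i < r) (a (delta_mx 0 i) : F) *: 'X^i.
have pE a t : (p a).[t] = a (\row_i t ^+ i).
  rewrite /p horner_sum [in RHS](row_sum_delta (\row_i t ^+ i)) linear_sum.
  by apply: eq_bigr => i _; rewrite linearZ /= mxE hornerZ hornerXn mulrC.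
have p0 a : a != 0 -> p a != 0.
  apply: contra_neq => pa0; apply/lfunP => y; rewrite zero_lfunE.
  rewrite (row_sum_delta y) linear_sum big1// => i _.
  rewrite linearZ /=; have /(congr1 (fun q : {poly F} => q`_i)) := pa0.
  rewrite /p coef_sum coef0 (bigD1 i)//= coefZ coefXn eqxx mulr1.
  rewrite big1 => [|j ji]; first by rewrite addr0 => ->; rewrite scaler0.
  by rewrite coefZ coefXn [(_ == _)%N]eq_sym -[(_ == _)%N]/(j == i) (negPf ji)
             mulr0.
pose P := \prod_(a <- s) p a.
have P0 : P != 0.
  by rewrite /P prodf_seq_neq0; apply/allP => a /s0 /p0.
(* A nonzero polynomial has fewer roots than its size, so [size P] distinct points cannot all be
   roots. *)
pose ts : seq F := [seq i%:R | i <- iota 0 (size P)].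
have /allPn[t _ Pt] : ~~ all (root P) ts.
  apply/negP => /(max_poly_roots P0); rewrite size_map size_iota ltnn.
  rewrite map_inj_uniq ?iota_uniq; first by move/(_ isT).
  by move=> i j /eqP; rewrite eqr_nat => /eqP.
exists (\row_i t ^+ i) => a sa; rewrite -pE; move: Pt; rewrite /root /P.
by rewrite horner_prod prodf_seq_neq0 => /allP /(_ _ sa).
Qed.

(** * Maximizing evaluation at a point of a chamber *)

Section EvalAt.
Context (F : fieldType) (V W : vectType F) (x : V).

Definition eval_at (f : 'Hom(V, W)) : W := f x.

Fact eval_at_is_linear : linear eval_at.
Proof. by move=> k f g; rewrite /eval_at add_lfunE scale_lfunE. Qed.

HB.instance Definition _ :=
  GRing.isLinear.Build F 'Hom(V, W) W _ eval_at eval_at_is_linear.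

End EvalAt.

(** The difference of the two values is a sum of nonnegative terms [d a], with [d a] nonzero exactly
    when [a] is positive at only one of [x] and [y]. Without strict inequality all terms vanish and
    the two sums of roots coincide. *)
Lemma sum_positive_lt (F : realType) (r : nat)
    (R : seq 'Hom('rV[F]_r, F^o)) (x y : 'rV[F]_r) :
  (forall a, a \in R -> a x != 0) ->
  \sum_(a <- R | 0 < a y) a != \sum_(a <- R | 0 < a x) a ->
  (\sum_(a <- R | 0 < a y) a) x < (\sum_(a <- R | 0 < a x) a) x.
Proof.
move=> Rx; apply: contraNT; rewrite -leNgt !sum_lfunE -subr_le0.
rewrite [X in X - _]big_mkcond [X in _ - X]big_mkcond -sumrB /= => le0.
pose d (a : 'Hom('rV[F]_r, F^o)) : F :=
  (if 0 < a x then a x else 0) - (if 0 < a y then a x else 0).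
have d0 a : 0 <= d a.
  rewrite /d; case: ifPn; case: ifPn => _; rewrite ?subrr ?subr0//.
    exact: ltW.
  by rewrite -leNgt sub0r oppr_ge0.
have : \sum_(a <- R) d a == 0 by rewrite eq_le le0 sumr_ge0.
rewrite psumr_eq0// => /allP dR.
apply/eqP; rewrite big_seq_cond [RHS]big_seq_cond; apply: eq_bigl => a.
have [aR/=|//] := boolP (a \in R).
have := dR _ aR; rewrite /d; case: ifPn; case: ifPn => // _ _.
  by rewrite subr0 (negPf (Rx _ aR)).
by rewrite sub0r oppr_eq0 (negPf (Rx _ aR)).
Qed.

(** * The convex hull of all $\rho^K$ and its integrality *)

Theorem proposition5p1 (F : realType) (r : nat)
    (A : {fset {vspace 'rV[F]_r}}) (R : {fset 'Hom('rV[F]_r, F^o)}) :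
  crystallographic_arrangement A R ->
  exists P : set 'Hom('rV[F]_r, F^o),
    [/\ polytope P,
        vertices P = [set rho R K | K in chambers A] &
        integral_wrt (half_root_lattice R) P].
Proof.
move=> [[dimA simpA] rootR crystR].
have R0 a : a \in R -> a != 0.
  move=> aR; have /dimA : lker a \in A.
    have : [set` A] (lker a) by rewrite rootR.1; exists a.
    by [].
  (* The zero functional has the whole space as kernel, of dimension r instead of r - 1. *)
  apply: contra_eq_neq => ->.
  have -> : lker (0 : 'Hom('rV[F]_r, F^o)) = fullv.
    by apply/vspaceP => v; rewrite memv_ker zero_lfunE eqxx memvf.
  by rewrite dimvf /dim /= mul1n neq_ltn ltnSn orbT.
pose sigma (x : 'rV[F]_r) := 2^-1 *: \sum_(a <- R | 0 < a x) a.
have chamberP K : chambers A K -> exists x, [/\ forall a, a \in R -> a x != 0,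
    K = sign_region R x, rho R K = sigma x & basis_of fullv (basis_at R K)].
  move=> cK; have [x Ax KE] := cK.
  rewrite (connected_component_complement rootR Ax) in KE.
  have Rx := (complementE x rootR).1 Ax.
  have [b bb coneE] := simpA K cK; rewrite -KE in coneE.
  exists x; rewrite -KE; split=> //; first exact: (rho_sign_region rootR Rx bb).
  exact: (basis_at_basis rootR Rx bb).
set C := [set rho R K | K in chambers A].
(* Each $\rho^K$ is half the sum of one of the finitely many subsets of [R]. *)
have finC : finite_set C.
  apply: (@sub_finite_set _ _
    [set 2^-1 *: \sum_(a <- S) a | S in [set` fpowerset R]]); last first.
    exact/finite_image/finite_fset.
  move=> _ [K cK <-]; exists (positive_roots R K) => //=.
  by rewrite fpowersetE fset_sub.
(* One chamber must exist, both for the hull to be nonempty and to provide a basis of the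
   lattice. *)
have [x0 Rx0] := exists_nonvanishing R0.
have Ax0 := (complementE x0 rootR).2 Rx0.
have cK0 : chambers A (connected_component (complement A) x0) by exists x0.
have sE v : v \in fset_set C <-> C v.
  by rewrite in_fset_set// inE.
have vertE : vertices (conv_hull (fset_set C)) = C.
  rewrite vertices_conv_hull ?fset_uniq//; first by apply/seteqP; split=> v /sE.
  move=> _ /sE [K /chamberP[x [Rx _ -> _]] <-].
  exists (linfun (eval_at x)) => _ /sE [K' /chamberP[y [_ _ -> _]] <-] yx.
  rewrite !lfunE /= /eval_at !scale_lfunE ltr_pM2l ?invr_gt0//.
  apply: sum_positive_lt => //; apply: contra_neq yx; rewrite /sigma.
  by move=> ->.
exists (conv_hull (fset_set C)); split=> //.
  exists (fset_set C) => //; apply/eqP => s0.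
  have /sE : C (rho R (connected_component (complement A) x0)).
    by exists (connected_component (complement A) x0).
  by rewrite -[_ \in _]/(_ \in enum_fset _) s0.
split; last first.
  rewrite vertE => _ [K _ <-]; exists (\sum_(a <- positive_roots R K) a) => //.
  rewrite big_seq; apply: big_ind => [||a].
  - exact: int_span0.
  - exact: int_spanD.
  - by rewrite !inE => /andP[aR _]; exact: int_span_mem (fset_uniq _) aR.
have [_ [_ _ _ basisB]] := chamberP _ cK0.
rewrite /half_root_lattice.
(* The crystallographic condition at this one chamber gives one inclusion, $B^K\subseteq R$ the
   other. *)
suff -> : int_span R =
    int_span (basis_at R (connected_component (complement A) x0)).
  by apply: is_lattice_scale_int_span basisB; rewrite invr_neq0 ?pnatr_eq0.
apply/seteqP; split; apply: int_span_sub => a.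
  exact: crystR.
by rewrite !inE => /andP[aR _]; exact: int_span_mem (fset_uniq _) aR.
Qed.
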